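(* Let $V\in C^\infty(\mathbb R,\mathbb R)$ and assume there exist $\eta,\alpha>0$ and $L_0\ge 1$ such that $V(q)\ge \eta|q|^\alpha$ for all $|q|\ge L_0$. Put $I(p,q)=p^2+2V(q)$ for $p,q\in\mathbb R$ and $Z_0=-2\inf_{q\in\mathbb R}V(q)$. Then for every $\epsilon>0$ the family $\{\mu_{\nu,\epsilon}\}_{\nu>0}$ satisfies a large deviations principle on $\mathbb R^2$ as $\nu\to\infty$ with the good rate function $(I+Z_0)/\epsilon$, i.e., $(I+Z_0)/\epsilon$ is a good rate function and $$\liminf_{\nu\to\infty}\frac1\nu\ln\mu_{\nu,\epsilon}(U)\ge-\inf_{(p,q)\in U}\frac1\epsilon\big(I(p,q)+Z_0\big)\quad\text{for every open } U\subseteq\mathbb R^2,$$ $$\limsup_{\nu\to\infty}\frac1\nu\ln\mu_{\nu,\epsilon}(C)\le-\inf_{(p,q)\in C}\frac1\epsilon\big(I(p,q)+Z_0\big)\quad\text{for every closed } C\subseteq\mathbb R^2.$$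
   Context: For $\nu,\epsilon>0$, $\mu_{\nu,\epsilon}$ is the Borel probability measure on $\mathbb R^2$ given by $d\mu_{\nu,\epsilon}=\frac{1}{Z_{\nu,\epsilon}}\exp\{-\frac{2\nu}{\epsilon}(\frac12p^2+V(q))\}\,dp\,dq$, where $Z_{\nu,\epsilon}=\int_{\mathbb R^2}e^{-\frac{2\nu}{\epsilon}(\frac12p^2+V(q))}\,dp\,dq$. It is the unique invariant measure of the Langevin equation $dP=-\nabla V(Q)\,dt-\nu P\,dt+\sqrt\epsilon\,dW$, $dQ=P\,dt$, with $W$ a one-dimensional standard Wiener process. A rate function is a lower semicontinuous map from the space to $[0,\infty]$; it is good if all its level sets $\{x: I(x)\le a\}$, $a\in[0,\infty)$, are compact. Conventions: $\ln 0=-\infty$, $\inf\emptyset=+\infty$. *)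

(* Defs.v *)
From HB Require Import structures.
From mathcomp Require Import all_boot all_order all_algebra.
From mathcomp Require Import all_classical all_reals all_analysis.

Set Implicit Arguments.
Unset Strict Implicit.
Unset Printing Implicit Defensive.

Import Order.TTheory GRing.Theory Num.Theory.
Import numFieldNormedType.Exports.

Local Open Scope classical_set_scope.
Local Open Scope ring_scope.

Definition smooth (R : realType) (V : R -> R) : Prop :=
  forall (n : nat) (x : R), derivable (derive1n n V) x 1.

Definition rate_function (R : realType) (T : topologicalType)
    (J : T -> \bar R) : Prop :=
  (forall x, (0 <= J x)%E) /\ lower_semicontinuous J.

Definition good_rate_function (R : realType) (T : topologicalType)
    (J : T -> \bar R) : Prop :=
  rate_function J /\
  forall a : R, 0 <= a -> compact [set x | (J x <= a%:E)%E].

(* The library conventions [lne 0 = -oo] and [ereal_inf set0 = +oo] are the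
   usual ones of large deviations theory. *)
Definition large_deviations_principle (R : realType) (T : topologicalType)
    (mu : R -> set T -> \bar R) (J : T -> \bar R) : Prop :=
  [/\ good_rate_function J,
      forall U : set T, open U ->
        (- ereal_inf (J @` U) <=
         limf_einf (fun nu : R => (nu^-1)%:E * lne (mu nu U))
                   (pinfty_nbhs R))%E &
      forall C : set T, closed C ->
        (limf_esup (fun nu : R => (nu^-1)%:E * lne (mu nu C))
                   (pinfty_nbhs R) <=
         - ereal_inf (J @` C))%E].

(* Points of the phase space R * R are pairs (p, q): momentum, position. *)
Definition gibbs_weight (R : realType) (V : R -> R) (nu eps : R)
    (x : R * R) : R :=
  expR (- (2 * nu / eps * (2^-1 * x.1 ^+ 2 + V x.2))).

Definition partition_function (R : realType) (V : R -> R) (nu eps : R) :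
    \bar R :=
  (\int[lebesgue_measure \x lebesgue_measure]_x
     (gibbs_weight V nu eps x)%:E)%E.

Definition gibbs_measure (R : realType) (V : R -> R) (nu eps : R)
    (A : set (R * R)) : \bar R :=
  ((partition_function V nu eps)^-1 *
   \int[lebesgue_measure \x lebesgue_measure]_(x in A)
     (gibbs_weight V nu eps x)%:E)%E.

Definition energy_rate (R : realType) (V : R -> R) (x : R * R) : R :=
  x.1 ^+ 2 + 2 * V x.2.

Definition energy_offset (R : realType) (V : R -> R) : R :=
  - 2 * inf (range V).

(* Main.v *)
Require Import Defs.
From mathcomp Require Import all_boot all_order all_algebra.
From mathcomp Require Import ring lra.
From mathcomp Require Import all_classical all_reals all_analysis.
From mathcomp Require Import measurable_realfun.

Set Implicit Arguments.
Unset Strict Implicit.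
Unset Printing Implicit Defensive.

Import Order.TTheory GRing.Theory Num.Theory.
Import numFieldNormedType.Exports.

Local Open Scope classical_set_scope.
Local Open Scope ring_scope.

(** Put [J x = (p ^+ 2 + 2 * V q - 2 * inf V) / eps] at [x = (p, q)].  Up to a
    factor that depends on [nu] only, the Gibbs weight is [expR (- (nu * J x))],
    and this factor cancels in the normalized measure.  So the theorem is an
    instance of Laplace's principle for the measures with density proportional
    to [expR (- (nu * J))], where [J] is continuous, nonnegative, has infimum
    [0] and compact sublevel sets, and [expR (- J)] is integrable with total
    mass [M].

    Both halves of Laplace's principle come from two elementary bounds.  If
    [J >= a] on [A], splitting [nu * J = (nu - 1) * J + J] shows that the
    integral over [A] is at most [expR (- ((nu - 1) * a)) * M]
    ([integral_weight_le]).  If [A] contains a set of Lebesgue measure [s] on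
    which [J <= b], the integral over [A] is at least [expR (- (nu * b)) * s]
    ([integral_weight_ge]); by continuity, such a set of positive measure
    exists near every point of an open set where [J < b] ([nbhs_box]).  Using
    one bound for the numerator and the other for the normalizing constant
    traps the measure of [A] between expressions [K * expR (- (nu * r))] with
    [K] independent of [nu] ([boltzmann_ge], [boltzmann_le]), and such a
    constant disappears in the limit of [nu^-1 * ln] ([limf_einf_exp_rate],
    [limf_esup_exp_rate]).

    The growth of [V] yields the properties of [J].  It bounds [V] below and
    confines its sublevel sets, which gives compactness.  For integrability,
    [expR (- J (p, q))] is dominated by a multiple of
    [((1 + p ^+ 2) * (1 + q ^+ 2))^-1], whose integral is finite by Tonelli's
    theorem; for small [alpha] this rests on the exponential of [`|q| `^ alpha]
    beating every power of [`|q|] ([expRN_powR_le_oneDsqrV]). *)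

(** * Integrals over arbitrary sets *)

(** The integral of a nonnegative function is a supremum over the simple
    functions below it, so it is monotone for arbitrary sets and functions.
    Thanks to this form, the bounds below apply to an open or closed set of the
    plane without showing that it lies in the product sigma-algebra. *)
Lemma ge0_integral_mono d (T : measurableType d) (R : realType)
    (mu : {measure set T -> \bar R}) (A B : set T) (f g : T -> \bar R) :
  (forall x, (0 <= f x)%E) -> (forall x, (0 <= g x)%E) ->
  (forall x, A x -> B x /\ (f x <= g x)%E) ->
  (\int[mu]_(x in A) f x <= \int[mu]_(x in B) g x)%E.
Proof.
move=> f0 g0 fg; rewrite !ge0_integralE => [|x _|x _]; [|exact: g0|exact: f0].
apply: le_ereal_sup => _ [h hf <-]; exists h => // x.
apply: (le_trans (hf x)); rewrite !patchE.
case: ifPn => [/set_mem /fg[Bx fgx]|_]; first by rewrite mem_set.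
by case: ifPn.
Qed.

(** * Exponential rates *)

Lemma lne_exp_rate (R : realType) (K b nu : R) : 0 < K -> 0 < nu ->
  (nu^-1%:E * lne (K * expR (- (nu * b)))%:E)%E = (- b + ln K / nu)%:E.
Proof.
move=> K0 nu0; rewrite lne_EFin ?mulr_gt0 ?expR_gt0//.
rewrite lnM ?posrE ?expR_gt0// expRK -EFinM; congr (_%:E).
by field; rewrite gt_eqF.
Qed.

(** The prefactor contributes [ln K / nu], which is absorbed by an arbitrarily
    small loss in the rate. *)
Lemma limf_einf_exp_rate (R : realType) (m : R -> \bar R) (K b : R) :
  0 < K ->
  (forall nu, 1 <= nu -> ((K * expR (- (nu * b)))%:E <= m nu)%E) ->
  ((- b)%:E <=
   limf_einf (fun nu : R => nu^-1%:E * lne (m nu)) (pinfty_nbhs R))%E.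
Proof.
move=> K0 Km; apply/lee_subgt0Pr => e e0; rewrite limf_einfE.
pose V := [set nu : R | 1 <= nu /\ `|ln K| / e <= nu].
apply: (@le_trans _ _
  (ereal_inf ((fun nu : R => (nu^-1)%:E * lne (m nu))%E @` V))); last first.
  apply: ereal_sup_ubound; exists V => //.
  by apply: filterI; apply: nbhs_pinfty_ge; exact: num_real.
apply: le_ereal_inf_tmp => _ [nu [nu1 Knu] <-].
have nu0 : 0 < nu by rewrite (lt_le_trans _ nu1).
apply: (@le_trans _ _ (nu^-1%:E * lne (K * expR (- (nu * b)))%:E)%E).
  rewrite lne_exp_rate// -EFinB lee_fin lerD2l.
  rewrite lerNl -mulNr ler_pdivrMr// -ler_pdivrMl// mulrC.
  by rewrite (le_trans _ Knu)// ler_pM2r ?invr_gt0// -normrN ler_norm.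
apply: lee_wpmul2l; first by rewrite lee_fin invr_ge0 ltW.
rewrite lee_lne ?Km// in_itv/= ?leey ?andbT.
  by rewrite lee_fin mulr_ge0 ?expR_ge0// ltW.
by apply: le_trans (Km _ nu1); rewrite lee_fin mulr_ge0 ?expR_ge0// ltW.
Qed.

Lemma limf_esup_exp_rate (R : realType) (m : R -> \bar R) (K b : R) :
  0 < K ->
  (forall nu, 1 <= nu -> (0 <= m nu <= (K * expR (- (nu * b)))%:E)%E) ->
  (limf_esup (fun nu : R => nu^-1%:E * lne (m nu)) (pinfty_nbhs R)
   <= (- b)%:E)%E.
Proof.
move=> K0 Km; apply/lee_addgt0Pr => e e0; rewrite limf_esupE.
pose V := [set nu : R | 1 <= nu /\ `|ln K| / e <= nu].
apply: (@le_trans _ _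
  (ereal_sup ((fun nu : R => (nu^-1)%:E * lne (m nu))%E @` V))).
  apply: ereal_inf_lbound; exists V => //.
  by apply: filterI; apply: nbhs_pinfty_ge; exact: num_real.
apply: ge_ereal_sup => _ [nu [nu1 Knu] <-].
have nu0 : 0 < nu by rewrite (lt_le_trans _ nu1).
apply: (@le_trans _ _ (nu^-1%:E * lne (K * expR (- (nu * b)))%:E)%E); last first.
  rewrite lne_exp_rate// -EFinD lee_fin lerD2l.
  rewrite ler_pdivrMr// -ler_pdivrMl// mulrC.
  by rewrite (le_trans _ Knu)// ler_pM2r ?invr_gt0// ler_norm.
apply: lee_wpmul2l; first by rewrite lee_fin invr_ge0 ltW.
have /andP[m0 mK] := Km _ nu1.
rewrite lee_lne// in_itv/= ?leey ?andbT//.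
by rewrite lee_fin mulr_ge0 ?expR_ge0// ltW.
Qed.

(** * Laplace's principle in the plane *)

Lemma nbhs_box (R : realType) (x : R * R) (A : set (R * R)) : nbhs x A ->
  exists2 B, (measurable B /\ B `<=` A) & exists2 s : R, 0 < s &
    (lebesgue_measure \x lebesgue_measure)%E B = s%:E.
Proof.
case: x => p q [[P Q] /= [/nbhs_ballP[r /= r0 rP] /nbhs_ballP[s /= s0 sQ]] PQA].
exists (ball p r `*` ball q s).
  split; first by apply: measurableX; exact: measurable_ball.
  by move=> [y z] [/= /rP Py /sQ Qz]; exact: PQA.
exists ((r *+ 2) * (s *+ 2)); first by rewrite mulr_gt0 ?mulrn_wgt0.
rewrite product_measure1E; [|exact: measurable_ball..].
by rewrite EFinM; congr (_ * _)%E; apply: lebesgue_measure_ball; exact: ltW.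
Qed.

Section laplace.
Variables (R : realType) (J : R * R -> R).
Hypotheses (Jm : measurable_fun setT J) (J0 : forall x, 0 <= J x).
Let mu := (@lebesgue_measure R \x @lebesgue_measure R)%E.
Variable M : R.
Hypothesis JM : (\int[mu]_x (expR (- J x))%:E)%E = M%:E.

(** One unit of [nu] is kept to make the weight integrable, the remaining
    [nu - 1] give the exponential decay. *)
Lemma integral_weight_le (c nu a : R) (A : set (R * R)) : 0 < c -> 1 <= nu ->
  (forall x, A x -> a <= J x) ->
  (\int[mu]_(x in A) (c * expR (- (nu * J x)))%:E <=
   (c * expR (- ((nu - 1) * a)) * M)%:E)%E.
Proof.
move=> c0 nu1 aJ; set k := c * _.
have k0 : 0 <= k by rewrite mulr_ge0 ?expR_ge0// ltW.
rewrite EFinM -JM -ge0_integralZl_EFin//; last first.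
  by apply/measurable_EFinP; do 2 apply: measurableT_comp => //.
apply: ge0_integral_mono => [x|x|x Ax]; rewrite ?lee_fin.
- by rewrite mulr_ge0 ?expR_ge0// ltW.
- by rewrite mulr_ge0 ?expR_ge0.
split=> //; rewrite /k -mulrA -expRD ler_pM2l// ler_expR.
have : 0 <= (nu - 1) * (J x - a) by rewrite mulr_ge0 ?subr_ge0 ?aJ.
by lra.
Qed.

Lemma integral_weight_ge (c nu b s : R) (A B : set (R * R)) : 0 < c -> 0 <= nu ->
  measurable B -> mu B = s%:E -> B `<=` A -> (forall x, B x -> J x <= b) ->
  ((c * expR (- (nu * b)) * s)%:E <=
   \int[mu]_(x in A) (c * expR (- (nu * J x)))%:E)%E.
Proof.
move=> c0 nu0 mB Bs BA Jb.
rewrite EFinM -Bs -integral_cst//.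
apply: ge0_integral_mono => [x|x|x Bx]; rewrite /cst ?lee_fin.
- by rewrite mulr_ge0 ?expR_ge0// ltW.
- by rewrite mulr_ge0 ?expR_ge0// ltW.
by split; [exact: BA|rewrite ler_pM2l// ler_expR lerN2 ler_wpM2l// Jb].
Qed.

(** The positive factor [c] cancels between the two integrals; it lets a weight
    be written with a [J] that is shifted to have infimum [0]. *)
Definition boltzmann (c nu : R) (A : set (R * R)) : \bar R :=
  ((\int[mu]_x (c * expR (- (nu * J x)))%:E)^-1 *
   \int[mu]_(x in A) (c * expR (- (nu * J x)))%:E)%E.

(* The set [B] witnesses that [J] takes values at most [b] with positive
   Lebesgue measure: it bounds integrals below, in the numerator when [B] is
   part of the set measured, and in the normalizing constant otherwise. *)
Variables (B : set (R * R)) (b s : R).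
Hypotheses (mB : measurable B) (Bs : mu B = s%:E) (s0 : 0 < s).
Hypothesis (Jb : forall x, B x -> J x <= b).

Lemma boltzmann_mass_gt0 : 0 < M.
Proof.
rewrite -lte_fin -JM.
have : ((1 * expR (- (1 * b)) * s)%:E <=
    \int[mu]_x (1 * expR (- (1 * J x)))%:E)%E.
  exact: (@integral_weight_ge _ _ _ _ _ B).
under eq_integral do rewrite !mul1r.
by apply: lt_le_trans; rewrite lte_fin !mul1r mulr_gt0 ?expR_gt0.
Qed.

Lemma integral_weightT (c nu : R) : 0 < c -> 1 <= nu ->
  exists z : R, [/\ (\int[mu]_x (c * expR (- (nu * J x)))%:E)%E = z%:E,
    0 < z, z <= c * M & c * expR (- (nu * b)) * s <= z].
Proof.
move=> c0 nu1.
have nu0 : 0 <= nu by exact: le_trans nu1.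
have := @integral_weight_le c nu 0 setT c0 nu1 (fun x _ => J0 x).
have := @integral_weight_ge c nu b s setT B c0 nu0 mB Bs (@subsetT _ _) Jb.
rewrite mulr0 oppr0 expR0 mulr1.
case: (X in (_ <= X)%E) => [z| |]//; rewrite !lee_fin => sz zM.
exists z; split=> //; apply: lt_le_trans sz.
by rewrite !mulr_gt0 ?expR_gt0.
Qed.

Lemma boltzmann_ge (c nu : R) (A : set (R * R)) : 0 < c -> 1 <= nu ->
  B `<=` A -> ((s / M * expR (- (nu * b)))%:E <= boltzmann c nu A)%E.
Proof.
move=> c0 nu1 BA; have M0 := boltzmann_mass_gt0.
have nu0 : 0 <= nu by exact: le_trans nu1.
have := @integral_weight_ge c nu b s A B c0 nu0 mB Bs BA Jb.
rewrite /boltzmann; have [z [-> z0 zM _]] := integral_weightT c0 nu1.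
rewrite inver gt_eqF// lee_pdivlMl// -EFinM => /(le_trans _); apply.
rewrite lee_fin (_ : c * _ * s = (c * M) * (s / M * expR (- (nu * b)))).
  by rewrite ler_wpM2r// mulr_ge0 ?expR_ge0// divr_ge0// ltW.
by field; rewrite gt_eqF.
Qed.

Lemma boltzmann_le (c nu a : R) (A : set (R * R)) : 0 < c -> 1 <= nu ->
  (forall x, A x -> a <= J x) ->
  (0 <= boltzmann c nu A <=
   (M / s * expR a * expR (- (nu * (a - b))))%:E)%E.
Proof.
move=> c0 nu1 aJ; have M0 := boltzmann_mass_gt0.
have := @integral_weight_le c nu a A c0 nu1 aJ.
rewrite /boltzmann; have [z [-> z0 _ sz]] := integral_weightT c0 nu1.
rewrite inver gt_eqF// => AM; apply/andP; split.
  apply: mule_ge0; first by rewrite lee_fin invr_ge0 ltW.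
  by apply: integral_ge0 => x _; rewrite lee_fin mulr_ge0 ?expR_ge0// ltW.
rewrite lee_pdivrMl// -EFinM (le_trans AM)// lee_fin.
rewrite (_ : c * _ * M =
    (c * expR (- (nu * b)) * s) * (M / s * expR a * expR (- (nu * (a - b))))).
  by rewrite ler_wpM2r// !mulr_ge0 ?expR_ge0 ?invr_ge0// ltW.
rewrite (_ : - ((nu - 1) * a) = - (nu * b) + (a + - (nu * (a - b)))); last by ring.
by rewrite !expRD; field; rewrite gt_eqF.
Qed.

End laplace.

(** Open sets: around a point [x] of [U] there is a box in [U] on which
    [J <= J x + e], and [boltzmann_ge] gives the rate [J x + e].  Closed sets: a
    box near an almost minimizer of [J] bounds the normalizing constant below,
    and [boltzmann_le] gives the rate [a - e] for every [a] below the infimum of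
    [J] on the set.  Letting [e] tend to [0] concludes. *)
Lemma laplace_principle (R : realType) (J : R * R -> R) (c : R -> R) :
  measurable_fun setT J -> continuous J -> (forall x, 0 <= J x) ->
  (forall e, 0 < e -> exists x, J x < e) ->
  (forall a, compact [set x | J x <= a]) ->
  (\int[lebesgue_measure \x lebesgue_measure]_x (expR (- J x))%:E < +oo)%E ->
  (forall nu, 0 < c nu) ->
  large_deviations_principle (fun nu => boltzmann J (c nu) nu)
    (fun x => (J x)%:E).
Proof.
move=> Jm Jc J0 Jinf Jcpt Joo c0.
have [M JM] : exists M, (\int[lebesgue_measure \x lebesgue_measure]_x
    (expR (- J x))%:E)%E = M%:E.
  exists (fine (\int[lebesgue_measure \x lebesgue_measure]_x
    (expR (- J x))%:E)%E).
  by rewrite fineK// ge0_fin_numE//; apply: integral_ge0.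
have Jlt x a : J x < a -> nbhs x [set y | J y < a].
  by move=> xa; exact: (cvgr_lt _ (Jc x)).
have Jgt x a : a < J x -> nbhs x [set y | a < J y].
  by move=> xa; exact: (cvgr_gt _ (Jc x)).
split.
- split; last by move=> a _; exact: Jcpt.
  split=> [x|x a]; first by rewrite lee_fin.
  by rewrite lte_fin => /Jgt; exists [set y | a < J y].
- move=> U oU; rewrite leeNl; apply: le_ereal_inf_tmp => _ [x Ux <-].
  rewrite leeNl -EFinN; apply/lee_subgt0Pr => e e0.
  have [|B [mB BU] [s s0 Bs]] := @nbhs_box _ x (U `&` [set y | J y < J x + e]).
    by apply: filterI; [exact: open_nbhs_nbhs|apply: Jlt; rewrite ltrDl].
  have Jb y : B y -> J y <= J x + e by move=> /BU[_] /ltW.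
  have M0 := boltzmann_mass_gt0 JM mB Bs s0 Jb.
  rewrite -EFinB -opprD.
  apply: (@limf_einf_exp_rate _ _ (s / M)); first by rewrite divr_gt0.
  move=> nu nu1; apply: boltzmann_ge JM _ _ _ mB Bs s0 Jb _ _ _ _ _ _ => // y.
  by case/BU.
- move=> C _; set L := limf_esup _ _; set I := ereal_inf _.
  have LI a : (a%:E <= I)%E -> (L <= (- a)%:E)%E.
    move=> aI; apply/lee_addgt0Pr => e e0.
    have [x xe] := Jinf _ e0.
    have [B [mB BJ] [s s0 Bs]] := nbhs_box (Jlt _ _ xe).
    have Jb y : B y -> J y <= e by move=> /BJ /ltW.
    have M0 := boltzmann_mass_gt0 JM mB Bs s0 Jb.
    rewrite -EFinD -[- a + e]opprK opprD opprK.
    apply: (@limf_esup_exp_rate _ _ (M / s * expR a)).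
      by rewrite mulr_gt0 ?expR_gt0 ?divr_gt0.
    move=> nu nu1; apply: boltzmann_le JM _ _ _ mB Bs s0 Jb _ _ _ _ _ _ _ => //.
    move=> y Cy; rewrite -lee_fin; apply: (le_trans aI).
    by apply: ereal_inf_lbound; exists y.
  have : (0 <= I)%E.
    by apply: le_ereal_inf_tmp => _ [x _ <-]; rewrite lee_fin.
  (* When the infimum is [+oo], every real [a] is admissible, which forces the
     upper limit to be [-oo]. *)
  move: LI; case: I => [r LI _| LI _|//]; first exact: LI.
  case: L LI => [l|/(_ 0 (leey _))|]// /(_ (1 - l) (leey _)).
  by rewrite lee_fin opprB lerDl oppr_ge0 ler10.
Qed.

(** * Integrability of exponential weights *)

Lemma integral_oneDsqrV_prod_lty (R : realType) (K : R) : 0 <= K ->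
  (\int[@lebesgue_measure R \x @lebesgue_measure R]_x
     (K * ((oneDsqr x.1)^-1 * (oneDsqr x.2)^-1))%:E < +oo)%E.
Proof.
move=> K0.
have u0 (x : R) : 0 <= (oneDsqr x)^-1.
  by rewrite invr_ge0 (le_trans _ (oneDsqr_ge1 x)).
have mu1 : measurable_fun setT (fun x : R => (oneDsqr x)^-1).
  by apply: continuous_measurable_fun; exact: continuous_oneDsqrV.
have uT : (\int[@lebesgue_measure R]_x ((oneDsqr x)^-1)%:E)%E = pi%:E.
  rewrite ge0_symfun_integralT//.
  - rewrite (_ : [set x | 0 <= x] = `[0, +oo[%classic); last first.
      by apply/seteqP; split=> x /=; rewrite in_itv/= andbT.
    by rewrite integral0y_oneDsqr -EFinM; congr (_%:E); field.
  - exact: continuous_oneDsqrV.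
  - by move=> x; rewrite /= /oneDsqr sqrrN.
rewrite fubini_tonelli1; first last.
- by move=> x; rewrite lee_fin !mulr_ge0.
- apply/measurable_EFinP; apply: measurable_funM => //.
  apply: measurable_funM.
    exact: (measurableT_comp mu1 measurable_fst).
  exact: (measurableT_comp mu1 measurable_snd).
rewrite /fubini_F /=.
under eq_integral => x _.
  under eq_integral => y _ do rewrite mulrA EFinM.
  rewrite ge0_integralZl_EFin//; [|exact/measurable_EFinP|exact: mulr_ge0].
  rewrite uT mulrC EFinM -muleA muleC.
  over.
rewrite ge0_integralZl//; [|exact/measurable_EFinP|..].
- by rewrite uT -!EFinM ltry.
- by rewrite -EFinM lee_fin mulr_ge0// pi_ge0.
Qed.

(** The constant comes from
    [(1 + a^-1) * (1 + a * t ^+ 2) = (1 + t ^+ 2) + (a^-1 + a * t ^+ 2)]. *)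
Lemma expRN_le_oneDsqrV (R : realType) (a t y : R) : 0 < a ->
  1 + a * t ^+ 2 <= expR y -> expR (- y) <= (1 + a^-1) * (oneDsqr t)^-1.
Proof.
move=> a0 ay; rewrite expRN.
have t0 := sqr_ge0 t; have ai0 : 0 < a^-1 by rewrite invr_gt0.
have u0 : 0 < oneDsqr t by rewrite (lt_le_trans ltr01)// oneDsqr_ge1.
rewrite ler_pdivlMr// ler_pdivrMl ?expR_gt0// mulrC.
apply: (@le_trans _ _ ((1 + a^-1) * (1 + a * t ^+ 2))); last first.
  by rewrite ler_wpM2l// addr_ge0// ltW.
rewrite /oneDsqr mulrDl mul1r mulrDr mulr1 mulKf ?gt_eqF//.
have : 0 <= a * t ^+ 2 by rewrite mulr_ge0// ltW.
by lra.
Qed.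

(** A single term of the exponential series, of an order [n.+1] with
    [alpha * n.+1 >= 2], already dominates [t ^+ 2]. *)
Lemma expRN_powR_le_oneDsqrV (R : realType) (c alpha : R) :
  0 < c -> 0 < alpha ->
  exists2 K, 0 <= K & forall t, 1 <= t ->
    expR (- (c * t `^ alpha)) <= K * (oneDsqr t)^-1.
Proof.
move=> c0 alpha0.
pose n := Num.bound (2 / alpha).
have an : 2 <= alpha * n.+1%:R.
  rewrite -ler_pdivrMl// mulrC.
  have : 2 / alpha < n%:R by apply: archi_boundP; rewrite divr_ge0// ltW.
  by move=> /ltW /le_trans; apply; rewrite ler_nat.
pose a := c ^+ n.+1 / n.+1`!%:R.
have a0 : 0 < a by rewrite divr_gt0 ?exprn_gt0// ltr0n fact_gt0.
exists (1 + a^-1) => [|t t1]; first by rewrite addr_ge0// invr_ge0 ltW.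
have t0 : 0 < t by exact: lt_le_trans t1.
apply: expRN_le_oneDsqrV => //.
have ct0 : 0 <= c * t `^ alpha by rewrite mulr_ge0 ?powR_ge0// ltW.
apply: le_trans (expR_ge1Dxn n ct0).
rewrite lerD2l exprMn mulrAC ler_wpM2r ?invr_ge0 ?ler0n//.
rewrite ler_wpM2l ?exprn_ge0 ?(ltW c0)//.
rewrite -[leRHS]powR_mulrn ?powR_ge0// -powRrM -powR_mulrn ?(ltW t0)//.
exact: ler_powR.
Qed.

(** * The rate function of a growing potential *)

Section potential.
Variables (R : realType) (V : R -> R).
Hypothesis Vc : continuous V.
Variables eta alpha L0 : R.
Hypotheses (eta0 : 0 < eta) (alpha0 : 0 < alpha) (L01 : 1 <= L0).
Hypothesis Vgrowth : forall q, L0 <= `|q| -> eta * `|q| `^ alpha <= V q.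

Lemma growth_has_lbound : has_lbound (range V).
Proof.
have [|q _ Vq] := @EVT_min _ V (- L0) L0 _ (continuous_subspaceT Vc).
  by have := L01; lra.
exists (Num.min (V q) 0) => _ [t _ <-].
have [tL|/ltW tL] := leP L0 `|t|; rewrite ge_min; apply/orP; [right|left].
  by apply: le_trans (Vgrowth tL); rewrite mulr_ge0 ?powR_ge0// ltW.
by apply: Vq; rewrite in_itv/= -ler_norml.
Qed.

(** Far out the growth condition gives the decay; on the bounded rest [V] is
    bounded below and [oneDsqr q <= oneDsqr L0]. *)
Lemma growth_expR_le (c : R) : 0 < c ->
  exists2 K, 0 <= K & forall q, expR (- (c * V q)) <= K * (oneDsqr q)^-1.
Proof.
move=> c0.
have [m Vm] := growth_has_lbound.
have [K K0 Kt] := expRN_powR_le_oneDsqrV (mulr_gt0 c0 eta0) alpha0.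
have L0u : 0 <= oneDsqr L0 by rewrite (le_trans ler01)// oneDsqr_ge1.
exists (K + expR (- (c * m)) * oneDsqr L0) => [|q].
  by rewrite addr_ge0// mulr_ge0// expR_ge0.
have u0 : 0 < oneDsqr q by rewrite (lt_le_trans ltr01)// oneDsqr_ge1.
rewrite mulrDl; have [qL|/ltW qL] := leP L0 `|q|.
  apply: (@le_trans _ _ (K * (oneDsqr q)^-1)); last first.
    by rewrite lerDl !mulr_ge0 ?expR_ge0// invr_ge0 ltW.
  have := Kt _ (le_trans L01 qL); rewrite /oneDsqr real_normK ?num_real//.
  apply: le_trans; rewrite ler_expR lerN2 -mulrA ler_pM2l//.
  exact: Vgrowth.
apply: (@le_trans _ _ (expR (- (c * m)) * oneDsqr L0 / oneDsqr q)); last first.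
  by rewrite lerDr mulr_ge0// invr_ge0 ltW.
apply: (@le_trans _ _ (expR (- (c * m)))).
  by rewrite ler_expR lerN2 ler_pM2l// Vm//; exists q.
rewrite -mulrA ler_peMr ?expR_ge0// ler_pdivlMr// mul1r lerD2l.
by rewrite -[q ^+ 2]real_normK ?num_real// ler_sqr ?nnegrE// (le_trans ler01).
Qed.

Variable eps : R.
Hypothesis eps0 : 0 < eps.

Let J (x : R * R) := (energy_rate V x + energy_offset V) / eps.

Let JE x : J x = x.1 ^+ 2 / eps + 2 / eps * (V x.2 - inf (range V)).
Proof. by rewrite /J /energy_rate /energy_offset; field; rewrite gt_eqF. Qed.

Let Vinf q : 0 <= V q - inf (range V).
Proof. by rewrite subr_ge0; apply: (ge_inf growth_has_lbound); exists q. Qed.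

Lemma rate_ge0 x : 0 <= J x.
Proof.
by rewrite JE addr_ge0// mulr_ge0 ?sqr_ge0 ?divr_ge0 ?invr_ge0 ?(ltW eps0).
Qed.

Lemma rate_lt e : 0 < e -> exists x, J x < e.
Proof.
move=> e0.
have d0 : 0 < eps / 2 * e by rewrite mulr_gt0 ?divr_gt0.
have [|_ [q _ <-] qe] := inf_adherent d0 (E := range V).
  by split; [exists (V 0), 0|exact: growth_has_lbound].
exists (0, q); rewrite JE /= expr0n mul0r add0r.
rewrite -ltr_pdivlMl ?divr_gt0// invf_div ltrBlDr addrC.
exact: qe.
Qed.

Lemma rate_continuous : continuous J.
Proof.
move=> x; apply: cvgM; last exact: cvg_cst.
apply: cvgD; last exact: cvg_cst.
apply: cvgD.
  exact: (cvgM cvg_fst cvg_fst).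
apply: cvgM; first exact: cvg_cst.
apply: (@continuous_comp _ _ _ (@snd R R) V x); first exact: cvg_snd.
exact: Vc.
Qed.

Lemma rate_measurable : measurable_fun setT J.
Proof.
apply: measurable_funM => //; apply: measurable_funD => //.
apply: measurable_funD.
  by apply: measurable_funX; exact: measurable_fst.
apply: measurable_funM => //.
apply: (measurableT_comp _ measurable_snd).
exact: continuous_measurable_fun.
Qed.

(** A bound on [J] bounds both of its nonnegative terms: the first confines [p],
    and the second bounds [V q], hence confines [q] by growth. *)
Lemma rate_compact a : compact [set x | J x <= a].
Proof.
(* The summand [1] makes [P <= P ^+ 2], so that [p ^+ 2 <= P] gives [`|p| <= P]. *)
pose P := 1 + `|a| * eps.
pose W := inf (range V) + eps / 2 * `|a|.
pose Q := Num.max L0 ((`|W| / eta) `^ alpha^-1).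
apply: (@subclosed_compact _ _ (`[- P, P]%classic `*` `[- Q, Q]%classic)).
- apply: (@closed_comp _ _ J [set y | y <= a]); last exact: closed_le.
  by move=> x _; exact: rate_continuous.
- by apply: compact_setX; exact: segment_compact.
move=> [p q] /= Ja.
have {}Ja : p ^+ 2 / eps + 2 / eps * (V q - inf (range V)) <= `|a|.
  by have := JE (p, q); rewrite /= => <-; exact: le_trans (ler_norm a).
have pe : 0 <= p ^+ 2 / eps by rewrite divr_ge0 ?sqr_ge0 ?ltW.
have qe : 0 <= 2 / eps * (V q - inf (range V)).
  by rewrite mulr_ge0 ?Vinf// divr_ge0// ltW.
have a0 := normr_ge0 a.
split; rewrite in_itv /= -ler_norml.
  have pa : p ^+ 2 <= `|a| * eps by rewrite -ler_pdivrMr//; lra.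
  have P1 : 1 <= P by rewrite lerDl mulr_ge0// ltW.
  rewrite -ler_sqr ?nnegrE// ?(le_trans ler01)// real_normK ?num_real//.
  rewrite (le_trans pa)// (@le_trans _ _ P) ?lerDr//.
  by rewrite expr2 ler_peMl// (le_trans ler01).
rewrite /Q le_max; have [//|/ltW L0q] := leP `|q| L0; apply/orP; right.
have VW : V q <= `|W|.
  apply: le_trans (ler_norm _); rewrite -lerBlDl -ler_pdivrMl ?divr_gt0//.
  by rewrite invf_div; lra.
have qW : `|q| `^ alpha <= `|W| / eta.
  by rewrite ler_pdivlMr// mulrC (le_trans (Vgrowth L0q)).
rewrite -[leLHS]powRr1// -(divff (lt0r_neq0 alpha0)) powRrM.
by apply: ge0_ler_powR; rewrite ?nnegrE ?powR_ge0 ?invr_ge0 ?divr_ge0// ltW.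
Qed.

(** The weight factors into a function of [p] and a function of [q]; the Gaussian
    factor is handled by [1 + y <= expR y] with [y = p ^+ 2 / eps]. *)
Lemma rate_integral_lty :
  (\int[@lebesgue_measure R \x @lebesgue_measure R]_x (expR (- J x))%:E
   < +oo)%E.
Proof.
have e2 : 0 < 2 / eps by rewrite divr_gt0.
have [K K0 VK] := growth_expR_le e2.
pose k := expR (2 / eps * inf (range V)) * (1 + eps).
have k0 : 0 <= k by rewrite mulr_ge0 ?expR_ge0// addr_ge0// ltW.
apply: le_lt_trans (integral_oneDsqrV_prod_lty (mulr_ge0 k0 K0)).
apply: ge0_integral_mono => [x|x|[p q] _]; rewrite ?lee_fin.
- exact: expR_ge0.
- by rewrite !mulr_ge0// addr_ge0// ltW.
split=> //=; rewrite JE /=.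
rewrite (_ : - _ = 2 / eps * inf (range V) + (- (p ^+ 2 / eps) +
  - (2 / eps * V q))); last by ring.
rewrite !expRD -/k [leRHS](_ : _ = expR (2 / eps * inf (range V)) *
  (((1 + eps) / oneDsqr p) * (K / oneDsqr q))); last by rewrite /k; ring.
rewrite ler_pM2l ?expR_gt0// ler_pM ?expR_ge0//.
rewrite -[X in 1 + X]invrK; apply: expRN_le_oneDsqrV.
  by rewrite invr_gt0.
by rewrite [_ * p ^+ 2]mulrC expR_ge1Dx.
Qed.

End potential.

(** * The Gibbs measures *)

Lemma gibbs_measure_boltzmann (R : realType) (V : R -> R) (nu eps : R) :
  0 < eps ->
  gibbs_measure V nu eps =
  boltzmann (fun x => (energy_rate V x + energy_offset V) / eps)
    (expR (nu * energy_offset V / eps)) nu.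
Proof.
move=> eps0.
suff wE x : gibbs_weight V nu eps x = expR (nu * energy_offset V / eps) *
    expR (- (nu * ((energy_rate V x + energy_offset V) / eps))).
  apply/funext => A; rewrite /gibbs_measure /partition_function /boltzmann.
  by congr (_^-1 * _)%E; apply: eq_integral => x _; rewrite wE.
rewrite -expRD /gibbs_weight /energy_rate; congr expR.
by field; rewrite gt_eqF.
Qed.

Lemma smooth_continuous (R : realType) (V : R -> R) : smooth V -> continuous V.
Proof.
by move=> sV x; apply/differentiable_continuous/derivable1_diffP/(sV 0%N).
Qed.

Theorem theorem3p2 (R : realType) (V : R -> R)
    (V_smooth : smooth V)
    (V_growth : exists eta alpha L0 : R,
        [/\ 0 < eta, 0 < alpha, 1 <= L0 &
            forall q : R, L0 <= `|q| -> eta * `|q| `^ alpha <= V q])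
    (eps : R) (eps_gt0 : 0 < eps) :
  large_deviations_principle
    (fun nu : R => gibbs_measure V nu eps)
    (fun x : R * R => ((energy_rate V x + energy_offset V) / eps)%:E).
Proof.
have Vc := smooth_continuous V_smooth.
case: V_growth => eta [alpha [L0 [eta0 alpha0 L01 VL]]].
rewrite (funext (fun nu => gibbs_measure_boltzmann V nu eps_gt0)).
apply: laplace_principle.
- exact: rate_measurable.
- exact: rate_continuous.
- exact: (rate_ge0 Vc eta0 L01 VL).
- exact: (rate_lt Vc eta0 L01 VL).
- exact: (rate_compact Vc eta0 alpha0 L01 VL).
- exact: (rate_integral_lty Vc eta0 alpha0 L01 VL).
- by move=> nu; exact: expR_gt0.
Qed.
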